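(* Let $T$ be a tree (finite or infinite). Then the following statements are equivalent: (i) The vertex set $V(T)$ is countable, i.e. $|V(T)|\le\aleph_0$. (ii) There is a non-degenerate labeling $l \colon V(T) \to \mathbb{R}^+$ for which the ultrametric space $(V(T), d_l)$ is locally finite.
   Context: Graphs are simple and undirected: $G=(V(G),E(G))$ with $E(G)$ a set of unordered pairs of distinct vertices; vertex sets may be infinite of any cardinality. A tree is a connected graph with nonempty vertex set and no cycles; any two distinct vertices of a tree are joined by exactly one (finite) path. $\mathbb{R}^+ = [0,\infty)$. A labeling of a tree $T$ is a map $l \colon V(T)\to\mathbb{R}^+$; it is non-degenerate if $\max\{l(u),l(v)\}>0$ for every edge $\{u,v\}\in E(T)$. Given a labeling $l$, define $d_l\colon V(T)\times V(T)\to\mathbb{R}^+$ by $d_l(u,u)=0$ and, for $u\neq v$, $d_l(u,v)=\max_{w\in V(P)} l(w)$, where $P$ is the path joining $u$ and $v$ in $T$ (endpoints included). It is known that $d_l$ is an ultrametric on $V(T)$ if and only if $l$ is non-degenerate. A set is countable if its cardinality is at most $\aleph_0$ (finite sets included). A subset $A$ of a metric space $(X,d)$ is bounded if $A\subseteq B_r(c)=\{x\in X\colon d(c,x)\le r\}$ for some $c\in X$, $r>0$. A metric space is locally finite if every bounded subset of it is finite. *)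

(* Defs.v *)
From mathcomp Require Import all_boot all_order all_algebra.
From mathcomp Require Import all_classical all_reals.

Set Implicit Arguments.
Unset Strict Implicit.
Unset Printing Implicit Defensive.

Import Order.TTheory GRing.Theory Num.Theory.
Local Open Scope classical_set_scope.
Local Open Scope ring_scope.

(* The edge set, a set of unordered pairs of distinct vertices, is encoded as  *)
(* a symmetric irreflexive relation. Vertex types have arbitrary cardinality:  *)
(* by classical choice every type carries a [choiceType] structure.            *)
Record sgraph := SGraph {
  vertex :> choiceType;
  adj : rel vertex;
  adj_sym : symmetric adj;
  adj_irr : irreflexive adj
}.

Arguments adj {s} _ _.

(* [u :: p] lists the vertices of a path from [u] to [v], endpoints included.  *)
Definition joins (G : sgraph) (u v : G) (p : seq G) : Prop :=
  [/\ path adj u p, last u p = v & uniq (u :: p)].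

Definition graph_connected (G : sgraph) : Prop :=
  forall u v : G, exists p : seq G, joins u v p.

(* A sequence of at most two distinct vertices can be an [adj]-cycle in the    *)
(* sense of [ucycle] without being a cycle of the graph.                       *)
Definition graph_acyclic (G : sgraph) : Prop :=
  ~ exists c : seq G, (2 < size c)%N /\ ucycle adj c.

Definition is_tree (G : sgraph) : Prop :=
  [/\ [set: G] !=set0, graph_connected G & graph_acyclic G].

Definition is_labeling (R : realType) (G : sgraph) (l : G -> R) : Prop :=
  forall v, 0 <= l v.

Definition nondegenerate_labeling (R : realType) (G : sgraph) (l : G -> R) : Prop :=
  forall u v : G, adj u v -> 0 < Num.max (l u) (l v).

(* In a tree this is the unique path joining [u] and [v]; the default [::] is  *)
(* only reached when [u] and [v] are not joined by any path.                   *)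
Definition path_between (G : sgraph) (u v : G) : seq G :=
  u :: xget [::] [set p | joins u v p].

(* The neutral element 0 is harmless since labels are nonnegative.             *)
Definition label_dist (R : realType) (G : sgraph) (l : G -> R) (u v : G) : R :=
  if u == v then 0 else \big[Num.max/0]_(w <- path_between u v) l w.

Definition closed_ball_of (R : realType) (X : Type) (d : X -> X -> R)
    (c : X) (r : R) : set X :=
  [set x | d c x <= r].

Definition metric_bounded (R : realType) (X : Type) (d : X -> X -> R)
    (A : set X) : Prop :=
  exists c : X, exists r : R, 0 < r /\ A `<=` closed_ball_of d c r.

Definition locally_finite_metric (R : realType) (X : Type) (d : X -> X -> R) : Prop :=
  forall A : set X, metric_bounded d A -> finite_set A.

(* Main.v *)
Require Import Defs.
From mathcomp Require Import all_boot all_order all_algebra.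
From mathcomp Require Import all_classical all_reals.

(** A locally finite space is the union of the balls of positive integer radius
    around any one of its points, because every distance is a real number and so
    lies below some integer.  These balls are finite, hence the space is
    countable ([locally_finite_metric_countable]).

    Conversely, the path from [c] to [v] contains its endpoint [v], so
    [l v <= label_dist l c v] whenever [c != v] ([label_le_dist]).  The ball of
    radius [r] around [c] therefore adds at most the point [c] to the sublevel
    set of [l] at [r], and it is enough to find a positive labeling whose
    sublevel sets are all finite ([locally_finite_label_dist]).  Numbering the
    vertices injectively by naturals and labeling the vertex numbered [n] with
    [n + 1] gives one; being positive, it is non-degenerate. *)

Import Order.TTheory GRing.Theory Num.Theory.
Local Open Scope classical_set_scope.
Local Open Scope ring_scope.

(** The balls of radius 1, 2, 3, ... around a point cover the space by countably
    many finite sets. *)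
Lemma locally_finite_metric_countable (R : realType) (X : Type)
    (d : X -> X -> R) :
  locally_finite_metric d -> countable [set: X].
Proof.
move=> lfd; have [->|/set0P[c _]] := eqVneq [set: X] set0.
  exact: countable0.
have -> : [set: X] = \bigcup_n closed_ball_of d c n.+1%:R.
  apply/seteqP; split=> // x _; exists (Num.truncn (d c x)) => //.
  exact/ltW/truncnS_gt.
apply: bigcup_countable => // n _; apply: finite_set_countable; apply: lfd.
by exists c, n.+1%:R; split.
Qed.

Lemma mem_path_between (G : sgraph) (u v : G) :
  graph_connected G -> v \in path_between u v.
Proof.
move=> connG.
have [_ last_v _] := @xgetPex _ [::] [set p | joins u v p] (connG u v).
by rewrite -{1}last_v mem_last.
Qed.

(** The label of the endpoint [v] is one of the labels whose maximum is the
    distance. *)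
Lemma label_le_dist (R : realType) (G : sgraph) (l : G -> R) (u v : G) :
  graph_connected G -> u != v -> l v <= label_dist l u v.
Proof.
move=> connG /negPf neq_uv; rewrite /label_dist neq_uv.
by apply: le_bigmax_seq => //; exact: mem_path_between.
Qed.

(** Away from its center, a ball of radius [r] consists of vertices of label at
    most [r]. *)
Lemma locally_finite_label_dist (R : realType) (G : sgraph) (l : G -> R) :
  graph_connected G -> (forall r, finite_set [set v | l v <= r]) ->
  locally_finite_metric (label_dist l).
Proof.
move=> connG finl A [c [r [_ Ar]]].
apply: (@sub_finite_set _ _ ([set c] `|` [set v | l v <= r])) => [x /Ar dr|].
  have [->|neq] := eqVneq c x; [by left|right].
  exact/(le_trans _ dr)/label_le_dist.
by rewrite finite_setU; split.
Qed.

Theorem theorem4 (R : realType) (T : sgraph) (treeT : is_tree T) :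
  countable [set: T] <->
  exists l : T -> R,
    [/\ is_labeling l, nondegenerate_labeling l & locally_finite_metric (label_dist l)].
Proof.
have [_ connT _] := treeT; split=> [|[l [_ _ lfl]]]; last first.
  exact: locally_finite_metric_countable lfl.
move=> /countable_injP [f injf].
exists (fun v => (f v).+1%:R); split=> [v|u v _|].
- exact: ler0n.
- by rewrite lt_max ltr0Sn.
apply: locally_finite_label_dist connT _ => r.
apply: (@sub_finite_set _ _ (f @^-1` `I_(Num.truncn r).+1)) => [v /= fvr|].
  have := le_lt_trans fvr (truncnS_gt r).
  by rewrite ltr_nat; apply: leq_trans.
apply: finite_preimage (finite_II _) => u v _ _.
by apply: injf; rewrite inE.
Qed.
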